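(* For $n\ge 1$ let $t_n$ be the arbor of size $n$ consisting of a root vertex with one element and $n-1$ child vertices, each a leaf with one element, and let $E_{t_n}(u)$ be the Ehrhart polynomial of the lattice polytope $Q_{t_n}$. Then, as formal power series in $s$ with coefficients in $\mathbb{Q}[u]$, $$1+\sum_{n\ge1}E_{t_n}(u)\,s^n=\frac12\left(1-\frac{s}{us+s-1}-\frac{s-1}{(us+s-1)^2}\right).$$
   Context: An arbor $t$ of size $n$ is a rooted tree in which each vertex $v$ is decorated by a non-empty subset of $[n]=\{1,\dots,n\}$, these subsets forming a partition of $[n]$. For a vertex $v$, $\mathcal{D}(v)\subseteq[n]$ is the set of all labels occurring in the sub-tree rooted at $v$ (that is, at $v$ and its descendants). The polytope $Q_t\subset\mathbb{R}^n$ is defined by $x_i\ge 0$ for all $i\in[n]$ and $\sum_{i\in\mathcal{D}(v)}x_i\le|\mathcal{D}(v)|$ for every vertex $v$; it is known to be a lattice polytope. For the arbor $t_n$ (labelling the root by $\{n\}$ and the leaves by $\{1\},\dots,\{n-1\}$; $t_1$ is a single vertex), the defining inequalities are $x_i\ge0$ for $1\le i\le n$, $x_i\le 1$ for $1\le i\le n-1$, and $x_1+\cdots+x_n\le n$. The Ehrhart polynomial $E_t(u)$ is the unique polynomial in $u$ such that for every integer $m\ge1$, $E_t(m)=|mQ_t\cap\mathbb{Z}^n|$, where $mQ_t=\{m\alpha:\alpha\in Q_t\}$. *)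

(* Defs.v *)
From HB Require Import structures.
From mathcomp Require Import all_boot all_order all_algebra.
From mathcomp Require Import all_classical reals.

Set Implicit Arguments.
Unset Strict Implicit.
Unset Printing Implicit Defensive.

Import Order.TTheory GRing.Theory Num.Theory.
Local Open Scope ring_scope.

(* A finite rooted tree is encoded by its parent function, extended to the
   root by [parent troot = troot]; connectedness and acyclicity amount to every
   vertex reaching the root by iterating [parent].  The label [i : 'I_n]
   stands for the element i + 1 of {1, ..., n}. *)
Record arbor (n : nat) := Arbor {
  vertex :> finType;
  troot : vertex;
  parent : vertex -> vertex;
  parent_root : parent troot = troot;
  parent_connect : forall v, fconnect parent v troot;
  decoration : vertex -> {set 'I_n};
  decoration_neq0 : forall v, decoration v != finset.set0;
  decoration_unique : forall i, exists! v, i \in decoration v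
}.

Definition subtree_labels n (t : arbor n) (v : t) : {set 'I_n} :=
  (\bigcup_(w : t | fconnect (@parent n t) w v) decoration w)%SET.

Definition arbor_polytope (R : realType) n (t : arbor n) : set 'rV[R]_n :=
  [set x : 'rV[R]_n |
    (forall i, 0 <= x ord0 i) /\
    (forall v : t, \sum_(i in subtree_labels v) x ord0 i
                     <= #|subtree_labels v|%:R)]%classic.

Arguments arbor_polytope R {n} t.

Definition dilate (R : realType) n (m : nat) (Q : set 'rV[R]_n) :
  set 'rV[R]_n := [set m%:R *: a | a in Q]%classic.

Definition integer_points (R : realType) n : set 'rV[R]_n :=
  [set x : 'rV[R]_n | forall i, x ord0 i \is a Num.int]%classic.

Arguments integer_points R n : clear implicits.

Definition is_ehrhart_poly (R : realType) n (Q : set 'rV[R]_n)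
    (p : {poly rat}) : Prop :=
  forall m : nat, (0 < m)%N ->
    exists2 k : nat,
      (dilate m Q `&` integer_points R n #= `I_k)%classic%card
      & p.[m%:R] = k%:R.

Lemma is_ehrhart_poly_unique (R : realType) n (Q : set 'rV[R]_n)
    (p q : {poly rat}) :
  is_ehrhart_poly Q p -> is_ehrhart_poly Q q -> p = q.
Proof.
move=> hp hq; apply/eqP; rewrite -subr_eq0; apply/negPn/negP => pq0.
pose s : seq rat := [seq i.+1%:R | i <- iota 0 (size (p - q))].
suff /(max_poly_roots pq0) : all (root (p - q)) s.
  rewrite size_map size_iota ltnn => h; suff: false by [].
  apply: h; rewrite map_inj_uniq ?iota_uniq // => i j /eqP.
  by rewrite eqr_nat => /eqP [].
apply/allP => _ /mapP [i _ ->].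
have [k hk ek] := hp i.+1 isT; have [l hl el] := hq i.+1 isT.
rewrite /root hornerD hornerN ek el subr_eq0; apply/eqP; congr (_%:R).
apply/card_eq_II; apply: card_eq_trans hl.
by rewrite card_eq_sym.
Qed.

(* The Ehrhart polynomial of [Q], with junk value 0 when there is none. *)
Definition ehrhart_poly (R : realType) n (Q : set 'rV[R]_n) : {poly rat} :=
  xget 0 [set p : {poly rat} | is_ehrhart_poly Q p]%classic.

Definition star_parent n (v : 'I_n.+1) : 'I_n.+1 := ord_max.

Fact star_parent_connect n (v : 'I_n.+1) :
  fconnect (@star_parent n) v ord_max.
Proof. exact: fconnect1. Qed.

Fact star_decoration_neq0 n (v : 'I_n.+1) : [set v]%SET != finset.set0.
Proof. by apply/set0Pn; exists v; rewrite inE. Qed.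

Fact star_decoration_unique n (i : 'I_n.+1) :
  exists! v : 'I_n.+1, i \in [set v]%SET.
Proof. by exists i; split=> [|v]; rewrite inE // => /eqP. Qed.

(* The arbor t_(n+1), as there is no arbor of size 0: the root [ord_max] is
   decorated by {n + 1} and has the n leaves 1, ..., n as children. *)
Definition star_arbor n : arbor n.+1 :=
  @Arbor n.+1 'I_n.+1 ord_max (@star_parent n) erefl
    (@star_parent_connect n) (fun v => [set v]%SET)
    (@star_decoration_neq0 n) (@star_decoration_unique n).

(* Formal power series in one indeterminate over a commutative ring, with the
   Cauchy product. *)
Record fps (R : comNzRingType) := Fps { fcoef : nat -> R }.

Section FpsRing.
Variable R : comNzRingType.
Implicit Types f g h : fps R.

Lemma fpsP f g : (forall n, fcoef f n = fcoef g n) -> f = g.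
Proof. by case: f => f; case: g => g /= fg; congr Fps; apply: funext. Qed.

HB.instance Definition _ := gen_eqMixin (fps R).
HB.instance Definition _ := gen_choiceMixin (fps R).

Definition fpsC (c : R) : fps R := Fps (fun n => if n == 0%N then c else 0).
Definition fpsX : fps R := Fps (fun n => (n == 1%N)%:R).

Definition fps_add f g : fps R := Fps (fun n => fcoef f n + fcoef g n).
Definition fps_opp f : fps R := Fps (fun n => - fcoef f n).
Definition fps_mul f g : fps R :=
  Fps (fun n => \sum_(i < n.+1) fcoef f i * fcoef g (n - i)).

Fact fps_addA : associative fps_add.
Proof. by move=> f g h; apply: fpsP => n /=; rewrite addrA. Qed.
Fact fps_addC : commutative fps_add.
Proof. by move=> f g; apply: fpsP => n /=; rewrite addrC. Qed.
Fact fps_add0 : left_id (fpsC 0) fps_add.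
Proof. by move=> f; apply: fpsP => n /=; case: ifP; rewrite add0r. Qed.
Fact fps_addN : left_inverse (fpsC 0) fps_opp fps_add.
Proof. by move=> f; apply: fpsP => n /=; case: ifP; rewrite addNr. Qed.

HB.instance Definition _ := GRing.isZmodule.Build (fps R)
  fps_addA fps_addC fps_add0 fps_addN.

Let trunc N f : {poly R} := \poly_(i < N) fcoef f i.

Let coef_trunc_mul N f g n : (n < N)%N ->
  (trunc N f * trunc N g)`_n = fcoef (fps_mul f g) n.
Proof.
move=> nN; rewrite coefM /=; apply: eq_bigr => i _.
rewrite !coef_poly (leq_ltn_trans (leq_subr _ _) nN).
by rewrite (leq_ltn_trans _ nN) // -ltnS.
Qed.

Fact fps_mulC : commutative fps_mul.
Proof.
move=> f g; apply: fpsP => n.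
by rewrite -!(@coef_trunc_mul n.+1) // mulrC.
Qed.

Fact fps_mulA : associative fps_mul.
Proof.
move=> f g h; apply: fpsP => n; pose t := trunc n.+1.
transitivity ((t f * (t g * t h))`_n).
  rewrite coefM; apply: eq_bigr => i _.
  by rewrite coef_trunc_mul ?ltnS ?leq_subr // coef_poly ltn_ord.
rewrite mulrA coefM; apply: eq_bigr => i _.
by rewrite coef_trunc_mul // coef_poly ltnS leq_subr.
Qed.

Fact fps_mul1 : left_id (fpsC 1) fps_mul.
Proof.
move=> f; apply: fpsP => n /=.
rewrite big_ord_recl /= mul1r subn0 big1 ?addr0 // => i _.
by rewrite mul0r.
Qed.

Fact fps_mulDl : left_distributive fps_mul fps_add.
Proof.
move=> f g h; apply: fpsP => n /=; rewrite -big_split /=.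
by apply: eq_bigr => i _; rewrite mulrDl.
Qed.

Fact fps_1_neq0 : fpsC 1 != 0.
Proof.
by apply/eqP => /(congr1 (fun f => fcoef f 0)) /eqP; rewrite /= oner_eq0.
Qed.

HB.instance Definition _ := GRing.Zmodule_isComNzRing.Build (fps R)
  fps_mulA fps_mulC fps_mul1 fps_mulDl fps_1_neq0.

Definition fps_unit : pred (fps R) := fun f => `[< exists g, g * f = 1 >].
Definition fps_inv f : fps R := xget f [set g | g * f = 1]%classic.

Fact fps_mulV : {in fps_unit, left_inverse 1 fps_inv *%R}.
Proof.
by move=> f /asboolP [g gf]; rewrite /fps_inv; case: xgetP => // /(_ g).
Qed.
Fact fps_unitP f g : g * f = 1 -> fps_unit f.
Proof. by move=> gf; apply/asboolP; exists g. Qed.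
Fact fps_inv_out : {in [predC fps_unit], fps_inv =1 id}.
Proof.
move=> f /negP nf; rewrite /fps_inv; case: xgetP => // g _ gf.
by case: nf; apply: fps_unitP gf.
Qed.

HB.instance Definition _ := GRing.ComNzRing_hasMulInverse.Build (fps R)
  fps_mulV fps_unitP fps_inv_out.

End FpsRing.

Arguments fpsX {R}.

(* Main.v *)
Require Import Defs.
From HB Require Import structures.
From mathcomp Require Import all_boot all_order all_algebra.
From mathcomp Require Import all_classical reals.
From mathcomp Require Import ring.

Set Implicit Arguments.
Unset Strict Implicit.
Unset Printing Implicit Defensive.

Import Order.TTheory GRing.Theory Num.Theory.
Local Open Scope ring_scope.

(** The dilate [m Q] of the polytope of t_(n+1) has as lattice points the pairs
    of a leaf vector [f] in {0, ..., m}^n and a root coordinate [y] with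
    [y + sum f <= m (n + 1)].  The reflection [f |-> m - f] shows that [sum f]
    averages to [m n / 2], so there are [(m + 1)^n (m + 1 + m n / 2)] of them.
    On the other side, [u s + s - 1] is minus the inverse of the geometric
    series of ratio [u + 1], and coefficients are compared. *)

(** Bridges finite-set cardinals and the initial segments [I_k] in which [is_ehrhart_poly] counts
    points. *)
Lemma card_eq_finset (T : finType) (A : {set T}) :
  ([set` A]%classic #= `I_#|A|)%card.
Proof.
have -> : ([set` A] = @enum_val T (mem A) @` [set: 'I_#|A|])%classic.
  apply/seteqP; split=> [x /= xA|_ [i _ <-]]; last exact: enum_valP.
  by exists (enum_rank_in xA x); rewrite ?enum_rankK_in.
apply: card_eq_trans (inj_card_eq (in2W enum_val_inj)) _.
by rewrite card_eq_sym; exact: card_II.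
Qed.

Section LatticePointCount.
Variables n m : nat.

Lemma sum_ffun_reflect :
  (2 * \sum_(f : {ffun 'I_n -> 'I_m.+1}) \sum_i f i = n * m * m.+1 ^ n)%N.
Proof.
pose r (f : {ffun 'I_n -> 'I_m.+1}) := [ffun i => rev_ord (f i)].
have rK : involutive r by move=> f; apply/ffunP => i; rewrite !ffunE rev_ordK.
(* Only one of the two copies of the sum is reindexed by [r], so each coordinate contributes
   [(m - f i) + f i = m]. *)
rewrite mul2n -addnn {1}(reindex_inj (inv_inj rK)) -big_split /=.
rewrite (eq_bigr (fun _ => (n * m)%N)) => [|f _].
  by rewrite sum_nat_const card_ffun !card_ord mulnC.
rewrite -big_split /= (eq_bigr (fun _ => m)) => [|i _].
  by rewrite sum_nat_const card_ord.
by rewrite ffunE /= subSS subnK // -ltnS.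
Qed.

(** Ensures that the natural-number subtraction [m * n.+1 - \sum_i f i] below is never truncated. *)
Lemma sum_ffun_le (f : {ffun 'I_n -> 'I_m.+1}) : (\sum_i f i <= m * n.+1)%N.
Proof.
apply: (@leq_trans (\sum_(i < n) m)); first by apply: leq_sum => i _; rewrite -ltnS.
by rewrite sum_nat_const card_ord mulnC leq_mul2l leqnSn orbT.
Qed.

Definition star_points :
    {set {ffun 'I_n -> 'I_m.+1} * 'I_(m * n.+1).+1} :=
  [set p : {ffun 'I_n -> 'I_m.+1} * 'I_(m * n.+1).+1 |
    \sum_i p.1 i + p.2 <= m * n.+1]%N%SET.

Lemma card_star_points :
  (2 * #|star_points| = m.+1 ^ n * (2 * m.+1 + n * m))%N.
Proof.
(* For fixed [f] the root coordinate takes [m * n.+1 - \sum_i f i + 1] values; adding [\sum_i f i]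
   back makes the contribution of every [f] the same. *)
have cardE : (#|star_points| + \sum_(f : {ffun 'I_n -> 'I_m.+1}) \sum_i f i
              = m.+1 ^ n * (m * n.+1).+1)%N.
  rewrite -sum1_card (eq_bigl (fun p : {ffun 'I_n -> 'I_m.+1} * 'I__ =>
    predT p.1 && (p.2 < (m * n.+1 - \sum_i p.1 i).+1)%N)) => [|p]; last first.
    by rewrite inE /= ltnS leq_subRL ?sum_ffun_le.
  rewrite -(pair_big_dep predT (fun (f : {ffun 'I_n -> 'I_m.+1})
    (y : 'I_(m * n.+1).+1) => (y < (m * n.+1 - \sum_i f i).+1)%N)
    (fun _ _ => 1%N)) /= -big_split /=.
  rewrite (eq_bigr (fun _ => (m * n.+1).+1)) => [|f _].
    by rewrite sum_nat_const card_ffun !card_ord.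
  have le_c : ((m * n.+1 - \sum_i f i).+1 <= (m * n.+1).+1)%N.
    by rewrite ltnS leq_subr.
  rewrite (big_ord_narrow le_c) sum1_card card_ord addSn subnK //.
  exact: sum_ffun_le.
have := sum_ffun_reflect; move: cardE.
set S := (\sum_f _)%N => cardE sumE.
apply: (@addIn (2 * S)%N); rewrite -mulnDr cardE sumE.
by ring.
Qed.

End LatticePointCount.

Section StarPolytope.
Variables (R : realType) (n : nat).

Lemma subtree_labels_star_root :
  subtree_labels (troot (star_arbor n)) = [set: 'I_n.+1]%SET.
Proof.
apply/setP => i; rewrite finset.in_setT; apply/bigcupP; exists i.
  exact: star_parent_connect.
by rewrite inE.
Qed.

Lemma subtree_labels_star_leaf (v : 'I_n.+1) : v != ord_max ->
  @subtree_labels _ (star_arbor n) v = [set v]%SET.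
Proof.
move=> vmax; apply/setP => i; apply/bigcupP/idP => [[w /= wv]|iv]; last first.
  by exists v => //=; apply: connect0.
suff -> : v = w by [].
(* A path of positive length ends at [ord_max], which [v] is not, so the path from [w] to [v] is
   empty. *)
move/iter_findex: wv vmax => <-.
by case: (findex _ _ _) => [//|k]; rewrite iterS /star_parent eqxx.
Qed.

Lemma dilate_star_polytopeP m (x : 'rV[R]_n.+1) : (0 < m)%N ->
  dilate m (arbor_polytope R (star_arbor n)) x <->
  [/\ forall i, 0 <= x ord0 i,
      forall j : 'I_n, x ord0 (lift ord_max j) <= m%:R
    & \sum_i x ord0 i <= (m * n.+1)%:R].
Proof.
move=> m_gt0; have m_gt0R : 0 < m%:R :> R by rewrite ltr0n.
have le_root (a : 'rV[R]_n.+1) :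
    (\sum_(i in subtree_labels (troot (star_arbor n))) a ord0 i
      <= #|subtree_labels (troot (star_arbor n))|%:R)
    = (\sum_i a ord0 i <= n.+1%:R).
  rewrite subtree_labels_star_root cardsT card_ord.
  by congr (_ <= _); apply: eq_bigl => i; rewrite inE.
split=> [[a [a_ge0 a_le] <-]|[x_ge0 x_le sum_le]].
  split=> [i|j|]; rewrite ?mxE ?mulr_ge0 //.
    have := a_le (lift ord_max j).
    rewrite subtree_labels_star_leaf 1?eq_sym ?neq_lift // big_set1 cards1.
    by rewrite -{2}[m%:R]mulr1 ler_pM2l.
  under eq_bigr do rewrite mxE.
  by rewrite -mulr_sumr natrM ler_pM2l // -le_root; apply: a_le.
exists (m%:R^-1 *: x); last by rewrite scalerA divff ?scale1r // gt_eqF.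
split=> [i|v]; first by rewrite mxE mulr_ge0 // invr_ge0 ltW.
case: (unliftP ord_max v) => [j|] ->; last first.
  rewrite le_root; under eq_bigr do rewrite mxE.
  by rewrite -mulr_sumr ler_pdivrMl // -natrM.
rewrite subtree_labels_star_leaf 1?eq_sym ?neq_lift // big_set1 cards1 mxE.
by rewrite ler_pdivrMl // mulr1.
Qed.

Section Point.
Variable m : nat.

(** [unlift ord_max] sends a leaf label to its index in ['I_n] and the root label to [None]. *)
Definition star_point (p : {ffun 'I_n -> 'I_m.+1} * 'I_(m * n.+1).+1) :
    'rV[R]_n.+1 :=
  \row_i (if unlift ord_max i is Some j then p.1 j else p.2 : nat)%:R.

Lemma star_point_leaf p (j : 'I_n) :
  star_point p ord0 (lift ord_max j) = (p.1 j)%:R.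
Proof. by rewrite mxE liftK. Qed.

Lemma star_point_root p : star_point p ord0 ord_max = p.2%:R.
Proof. by rewrite mxE unlift_none. Qed.

Lemma star_point_inj : injective star_point.
Proof.
move=> p q pq; apply: injective_projections; last first.
  apply/val_inj/eqP; rewrite -(eqr_nat R) /=.
  by rewrite -!star_point_root pq.
apply/ffunP => j; apply/val_inj/eqP; rewrite -(eqr_nat R) /=.
by rewrite -!star_point_leaf pq.
Qed.

Lemma sum_lift_max (x : 'I_n.+1 -> R) :
  \sum_i x i = \sum_(j < n) x (lift ord_max j) + x ord_max.
Proof.
rewrite big_ord_recr /=; congr (_ + _); apply: eq_bigr => j _.
by congr x; apply/val_inj/esym/lift_max.
Qed.

Lemma integer_points_dilate_star : (0 < m)%N ->
  (dilate m (arbor_polytope R (star_arbor n)) `&` integer_points R n.+1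
   = star_point @` [set` star_points n m])%classic.
Proof.
move=> m_gt0; apply/seteqP; split=> [x [/(dilate_star_polytopeP _ m_gt0)]|].
  case=> x_ge0 x_le sum_le x_int.
  have xE i : x ord0 i = (Num.truncn (x ord0 i))%:R.
    by rewrite truncnK // natrEint x_int x_ge0.
  move: sum_le; rewrite sum_lift_max xE.
  under eq_bigr do rewrite xE.
  rewrite -natr_sum -natrD ler_nat => sum_le.
  (* [inord] is faithful only within range: leaf coordinates are at most [m], and the root
     coordinate is at most the total sum since the leaf coordinates are nonnegative. *)
  pose p := ([ffun j => inord (Num.truncn (x ord0 (lift ord_max j)))],
    inord (Num.truncn (x ord0 ord_max))) :
    {ffun 'I_n -> 'I_m.+1} * 'I_(m * n.+1).+1.
  have p1E j : p.1 j = Num.truncn (x ord0 (lift ord_max j)) :> nat.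
    by rewrite ffunE inordK // ltnS -(ler_nat R) -xE.
  have p2E : p.2 = Num.truncn (x ord0 ord_max) :> nat.
    by rewrite inordK // ltnS (leq_trans _ sum_le) // leq_addl.
  exists p.
    by rewrite /= inE p2E; under eq_bigr do rewrite p1E.
  apply/rowP => i; case: (unliftP ord_max i) => [j|] ->.
    by rewrite star_point_leaf p1E -xE.
  by rewrite star_point_root p2E -xE.
move=> _ [p /= p_in <-]; split=> [|i]; last by rewrite mxE natr_int.
apply/dilate_star_polytopeP => //; split=> [i|j|]; first by rewrite mxE.
  by rewrite star_point_leaf ler_nat -ltnS.
rewrite sum_lift_max star_point_root; under eq_bigr do rewrite star_point_leaf.
by rewrite -natr_sum -natrD ler_nat; rewrite inE in p_in.
Qed.

End Point.

(** At [m], the first factor counts the leaf vectors and the second is the average number of root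
    values, [m (n + 1) + 1 - m n / 2]. *)
Lemma ehrhart_poly_star : ehrhart_poly (arbor_polytope R (star_arbor n)) =
  ('X + 1) ^+ n * ('X + 1 + (n%:R / 2%:R) *: 'X).
Proof.
set E := (E in _ = E).
suff E_ehrhart : is_ehrhart_poly (arbor_polytope R (star_arbor n)) E.
  by apply: xget_unique => // p /is_ehrhart_poly_unique; apply.
move=> m m_gt0; exists #|star_points n m|.
  rewrite integer_points_dilate_star //.
  apply: card_eq_trans (inj_card_eq (in2W (@star_point_inj m))) _.
  exact: card_eq_finset.
apply: (@mulfI _ 2%:R) => //.
rewrite -natrM card_star_points !hornerE.
rewrite natrM natrX natrD !natrM -[m.+1]addn1 natrD.
by rewrite /=; field.
Qed.

End StarPolytope.

Section PowerSeries.
Variable A : comNzRingType.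
Implicit Types f : fps A.

Lemma fcoefD f g k : fcoef (f + g) k = fcoef f k + fcoef g k.
Proof. by []. Qed.

Lemma fcoefN f k : fcoef (- f) k = - fcoef f k.
Proof. by []. Qed.

Lemma fcoefM f g k :
  fcoef (f * g) k = \sum_(i < k.+1) fcoef f i * fcoef g (k - i).
Proof. by []. Qed.

Lemma fcoef1 k : fcoef (1 : fps A) k = (k == 0%N)%:R.
Proof. by case: k. Qed.

Lemma fcoefCM c f k : fcoef (fpsC c * f) k = c * fcoef f k.
Proof.
rewrite fcoefM big_ord_recl /= subn0 big1 ?addr0 // => i _.
by rewrite mul0r.
Qed.

Lemma fcoefXM0 f : fcoef (fpsX * f) 0 = 0.
Proof. by rewrite fcoefM big_ord1 mul0r. Qed.

Lemma fcoefXMS f k : fcoef (fpsX * f) k.+1 = fcoef f k.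
Proof.
rewrite fcoefM !big_ord_recl /= mul0r add0r mul1r subSS subn0.
by rewrite big1 ?addr0 // => i _; rewrite mul0r.
Qed.

Definition fps_geom (a : A) : fps A := Fps (fun k => a ^+ k).

Lemma fps_geomE a : (1 - fpsC a * fpsX) * fps_geom a = 1.
Proof.
apply: fpsP => k; rewrite mulrBl mul1r -mulrA fcoefD fcoefN fcoefCM fcoef1.
by case: k => [|k]; rewrite ?fcoefXM0 ?fcoefXMS /= ?mulr0 ?subr0 // exprS subrr.
Qed.

(** All [k.+1] terms of the Cauchy product equal [a ^+ k]. *)
Lemma fcoef_geom_sqr a k : fcoef (fps_geom a ^+ 2) k = a ^+ k *+ k.+1.
Proof.
rewrite expr2 fcoefM (eq_bigr (fun _ => a ^+ k)) => [|i _].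
  by rewrite sumr_const card_ord.
by rewrite /= -exprD subnKC // -ltnS.
Qed.

End PowerSeries.

Theorem theorem3p1 (R : realType) :
  let s : fps {poly rat} := fpsX in
  let u : fps {poly rat} := fpsC 'X in
  1 + Fps (fun k : nat =>
         if k is n.+1 then ehrhart_poly (arbor_polytope R (star_arbor n))
         else 0)
  = 2%:R^-1 * (1 - s / (u * s + s - 1) - (s - 1) / (u * s + s - 1) ^+ 2).
Proof.
move=> s u; pose G : fps {poly rat} := fps_geom ('X + 1).
have uE : fpsC ('X + 1) = u + 1 :> fps {poly rat}.
  by apply: fpsP => -[|k] //=; rewrite addr0.
have GE : (u * s + s - 1) * - G = 1.
  by rewrite -[RHS](fps_geomE ('X + 1)) uE -/G -/s; ring.
have wV : (u * s + s - 1)^-1 = - G.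
  (* Inversion fixes non-units by convention, so the quotients have their intended meaning only once
     invertibility is shown. *)
  have w_unit : u * s + s - 1 \is a GRing.unit.
    by apply/unitrPr; exists (- G).
  by apply: (mulrI w_unit); rewrite divrr.
have two_unit : (2%:R : fps {poly rat}) \is a GRing.unit.
  apply/unitrPr; exists (fpsC (2%:R^-1)%:P).
  rewrite mulrC; apply: fpsP => k; rewrite fcoefCM.
  case: k => [|k]; rewrite fcoefD fcoef1 /= ?addr0 ?mulr0 //.
  by rewrite -polyCD -polyCM mulVf.
rewrite -exprVn wV sqrrN; apply: (mulrI two_unit); rewrite mulVKr //.
have -> : 1 - s * - G - (s - 1) * G ^+ 2 = 1 + s * G + G ^+ 2 - s * G ^+ 2.
  by ring.
(* With 2 split as [1 + 1], each coefficient on the left is a plain sum of two equal terms. *)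
rewrite -[2%:R]/(1 + 1 : fps _) mulrDl !mul1r.
apply: fpsP => -[|k]; rewrite !(fcoefD, fcoefN) fcoef1 ?fcoefXM0 ?fcoefXMS.
  by rewrite fcoef_geom_sqr /= expr0; ring.
rewrite !fcoef_geom_sqr /= ehrhart_poly_star.
(* The fraction [k / 2] enters only through [h + h]; the rest is the identity [1 + (k + 2)(X + 1) -
   (k + 1) = 2 (X + 1) + k X], multiplied by [(X + 1) ^ k]. *)
set h := (_ / _) *: 'X; have hD : h + h = 'X *+ k.
  by rewrite -scalerDl -[RHS]scaler_nat; congr (_ *: _); field.
transitivity (('X + 1) ^+ k * ('X + 1 + ('X + 1) + (h + h))); first by ring.
by rewrite hD exprS; ring.
Qed.
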